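(* Let $B$ be an admissible Banach sequence space over $\mathbb{Z}$, let $X$ be a Banach space, and let $(A_m)_{m\in\mathbb{Z}}$ be a sequence of bounded linear operators on $X$ that admits an exponential trichotomy (with projections $P_m^1,P_m^2,P_m^3$). Let $G\colon X_B\to X_B$ be the bounded linear operator associated with this trichotomy (defined in the context). Let $c>0$ and let $f_n\colon X\to X$, $n\in\mathbb{Z}$, be maps such that $\|f_n(x)-f_n(y)\|\le c\|x-y\|$ for all $n\in\mathbb{Z}$ and $x,y\in X$. Assume that $$c\,\|G\|<1.$$ Then the system $x_{n+1}=F_n(x_n)$, $n\in\mathbb{Z}$, where $F_n:=A_n+f_n$, has the $B$-Lipschitz shadowing property.
   Context: **Admissible Banach sequence spaces.** Let $\mathcal S(\mathbb Z)$ be the set of all real sequences $\mathbf s=(s_n)_{n\in\mathbb Z}$. A linear subspace $B\subset\mathcal S(\mathbb Z)$ with a norm $\|\cdot\|_B$ is a normed sequence space if whenever $\mathbf s'\in B$ and $|s_n|\le|s_n'|$ for all $n\in\mathbb Z$, then $\mathbf s\in B$ and $\|\mathbf s\|_B\le\|\mathbf s'\|_B$. If it is complete, it is a Banach sequence space. A Banach sequence space $B$ is admissible if (1) $\chi_{\{n\}}\in B$ and $\|\chi_{\{n\}}\|_B>0$ for all $n\in\mathbb Z$ ($\chi$ denotes the characteristic function); (2) for each $\mathbf s\in B$ and $m\in\mathbb Z$ the shifted sequence $(s_{n+m})_{n\in\mathbb Z}$ belongs to $B$ and has the same norm as $\mathbf s$. It is assumed throughout that $\|\chi_{\{0\}}\|_B=1$.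 For a Banach space $X$, $X_B$ is the Banach space of sequences $\mathbf x=(x_n)_{n\in\mathbb Z}\subset X$ with $(\|x_n\|)_{n\in\mathbb Z}\in B$, with norm $\|\mathbf x\|_B:=\|(\|x_n\|)_{n\in\mathbb Z}\|_B$. **Exponential trichotomy.** For $m\ge n$ set $\mathcal A(m,n)=A_{m-1}\cdots A_n$ if $m>n$ and $\mathcal A(m,m)=\mathrm{Id}$. The sequence $(A_m)_{m\in\mathbb Z}$ admits an exponential trichotomy if there exist $C,\lambda>0$ and projections $P_m^i$ on $X$, $m\in\mathbb Z$, $i\in\{1,2,3\}$, such that: (1) $P_m^1+P_m^2+P_m^3=\mathrm{Id}$; (2) $P_m^iP_m^j=0$ for $i\ne j$; (3) $P_{m+1}^iA_m=A_mP_m^i$ for all $m,i$; (4) $A_m|_{\ker P_m^1}\colon\ker P_m^1\to\ker P_{m+1}^1$ is invertible for each $m$; (5) $\|\mathcal A(m,n)P_n^1\|\le Ce^{-\lambda(m-n)}$ for $m\ge n$; (6) $\|\mathcal A(m,n)P_n^2\|\le Ce^{-\lambda(n-m)}$ for $m\le n$, where for $m\le n$ one sets $\mathcal A(m,n):=(\mathcal A(n,m)|_{\ker P_m^1})^{-1}\colon\ker P_n^1\to\ker P_m^1$; (7) $\|\mathcal A(m,n)P_n^3\|\le Ce^{-\lambda(m-n)}$ for $m\ge n\ge 0$ and $\|\mathcal A(m,n)P_n^3\|\le Ce^{-\lambda(n-m)}$ for $m\le n\le 0$. **The operator $G$.** For $n,m\in\mathbb Z$ set $$\mathcal G(n,m):=\begin{cases}\mathcal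 A(n,m)P_m^1 & \text{if } m\le 0\le n \text{ or } m\le n\le 0;\\ -\mathcal A(n,m)(\mathrm{Id}-P_m^1) & \text{if } n<m\le 0;\\ \mathcal A(n,m)(\mathrm{Id}-P_m^2) & \text{if } 0<m\le n;\\ -\mathcal A(n,m)P_m^2 & \text{if } 0\le n<m \text{ or } n\le 0<m.\end{cases}$$ For $\mathbf y\in X_B$, $(G\mathbf y)_n:=\sum_{m\in\mathbb Z}\mathcal G(n,m+1)y_{m+1}$, $n\in\mathbb Z$. This is a bounded linear operator on $X_B$; $\|G\|$ denotes its operator norm. **Shadowing.** For $\delta>0$, a sequence $(y_n)_{n\in\mathbb Z}\subset X$ is a $(\delta,B)$-pseudotrajectory for $x_{n+1}=F_n(x_n)$ if $(y_{n+1}-F_n(y_n))_{n\in\mathbb Z}\in X_B$ and $\|(y_{n+1}-F_n(y_n))_{n\in\mathbb Z}\|_B\le\delta$. The system has the $B$-shadowing property if for every $\varepsilon>0$ there is $\delta>0$ such that for every $(\delta,B)$-pseudotrajectory $(y_n)_{n\in\mathbb Z}$ there is a sequence $(x_n)_{n\in\mathbb Z}$ with $x_{n+1}=F_n(x_n)$ for all $n\in\mathbb Z$, $(x_n-y_n)_{n\in\mathbb Z}\in X_B$ and $\|(x_n-y_n)_{n\in\mathbb Z}\|_B\le\varepsilon$. It has the $B$-Lipschitz shadowing property if moreover there is $L>0$ (independent of $\varepsilon$) such that one can take $\delta=L\varepsilon$. *)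

(* Defs.v *)
From HB Require Import structures.
From mathcomp Require Import all_boot all_order all_algebra.
From mathcomp Require Import all_classical all_reals all_analysis.
From mathcomp.analysis.showcase Require summability.

Set Implicit Arguments.
Unset Strict Implicit.
Unset Printing Implicit Defensive.
Import Order.TTheory GRing.Theory Num.Theory.
Import numFieldNormedType.Exports.
Local Open Scope classical_set_scope.
Local Open Scope ring_scope.

(* [seqnorm] is only meaningful on [seqs]. *)
Record normedSeqSpace (R : realType) := NormedSeqSpace {
  seqs : set (int -> R);
  seqnorm : (int -> R) -> R;
  seqs0 : seqs (fun=> 0);
  seqsD : forall s t, seqs s -> seqs t -> seqs (fun n => s n + t n);
  seqsZ : forall a s, seqs s -> seqs (fun n => a * s n);
  seqnorm_ge0 : forall s, seqs s -> 0 <= seqnorm s;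
  seqnorm0_eq0 : forall s, seqs s -> seqnorm s = 0 -> s = (fun=> 0);
  seqnormZ : forall a s, seqs s -> seqnorm (fun n => a * s n) = `|a| * seqnorm s;
  ler_seqnormD : forall s t, seqs s -> seqs t ->
    seqnorm (fun n => s n + t n) <= seqnorm s + seqnorm t;
  seqs_solid : forall s s', seqs s' -> (forall n, `|s n| <= `|s' n|) -> seqs s;
  ler_seqnorm : forall s s', seqs s' -> (forall n, `|s n| <= `|s' n|) ->
    seqnorm s <= seqnorm s'
}.

Section SequenceSpaces.
Variables (R : realType) (B : normedSeqSpace R).

Definition banach_seq_space : Prop :=
  forall u : nat -> int -> R, (forall k, seqs B (u k)) ->
    (forall e : R, 0 < e -> exists N : nat, forall k l : nat,
       (N <= k)%N -> (N <= l)%N -> seqnorm B (fun n => u k n - u l n) < e) ->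
  exists2 s : int -> R, seqs B s &
    (fun k => seqnorm B (fun n => u k n - s n)) @ \oo --> (0 : R).

Record admissible : Prop := Admissible {
  adm_banach : banach_seq_space;
  adm_indic : forall n : int,
    seqs B \1_[set n] /\ 0 < seqnorm B \1_[set n];
  adm_shift : forall (s : int -> R) (m : int), seqs B s ->
    seqs B (fun n => s (n + m)) /\ seqnorm B (fun n => s (n + m)) = seqnorm B s
}.

Variable X : completeNormedModType R.

Definition XB : set (int -> X) := [set x | seqs B (fun n => `|x n|)].

Definition XBnorm (x : int -> X) : R := seqnorm B (fun n => `|x n|).

End SequenceSpaces.

(* Extended-real valued: an unbounded operator has norm +oo. *)
Definition opnorm (R : realType) (V : Type) (D : set V) (N : V -> R)
    (T : V -> V) : \bar R :=
  ereal_sup [set (N (T v))%:E | v in [set v | D v /\ N v <= 1]].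

Inductive tri := tri1 | tri2 | tri3.

Section Trichotomy.
Variables (R : realType) (X : completeNormedModType R).
Variables (A : int -> {linear X -> X}) (P : tri -> int -> {linear X -> X}).

Definition opker (T : X -> X) : set X := T @^-1` [set 0].

(* A_{n+k-1} o ... o A_n *)
Fixpoint forward (n : int) (k : nat) (x : X) : X :=
  if k is k'.+1 then A (n + k'%:Z) (forward n k' x) else x.

(* For m < n this is the inverse of A(n,m) : ker P_m^1 -> ker P_n^1, extended
   arbitrarily outside ker P_n^1 ; the trichotomy conditions make A(n,m) a
   bijection between these kernels, and only vectors of ker P_n^1 are ever fed
   to it below. *)
Definition evol (m n : int) : X -> X :=
  if n <= m then forward n `|m - n|%N
  else 'pinv_(fun=> 0) (opker (P tri1 m)) (forward m `|n - m|%N).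

Definition normX (T : X -> X) : \bar R := opnorm [set: X] Num.norm T.

Record exp_trichotomy : Prop := ExpTrichotomy {
  tri_bounded : forall i m, bounded_near (P i m) (nbhs (0 : X));
  tri_idem : forall i m x, P i m (P i m x) = P i m x;
  tri_sum : forall m x, P tri1 m x + P tri2 m x + P tri3 m x = x;
  tri_orth : forall i j m x, i <> j -> P i m (P j m x) = 0;
  tri_comm : forall i m x, P i (m + 1) (A m x) = A m (P i m x);
  tri_inv : forall m,
    set_bij (opker (P tri1 m)) (opker (P tri1 (m + 1))) (A m);
  tri_exp : exists C l : R, [/\ 0 < C, 0 < l &
    [/\ forall m n : int, n <= m ->
          (normX (evol m n \o P tri1 n) <= (C * expR (- l * (m - n)%:~R))%:E)%E,
        forall m n : int, m <= n ->
          (normX (evol m n \o P tri2 n) <= (C * expR (- l * (n - m)%:~R))%:E)%E,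
        forall m n : int, 0 <= n -> n <= m ->
          (normX (evol m n \o P tri3 n) <= (C * expR (- l * (m - n)%:~R))%:E)%E
      & forall m n : int, m <= n -> n <= 0 ->
          (normX (evol m n \o P tri3 n) <= (C * expR (- l * (n - m)%:~R))%:E)%E]]
}.

(* The last case is exactly 0 <= n < m or n <= 0 < m. *)
Definition green (n m : int) (x : X) : X :=
  if (m <= 0 <= n) || (m <= n <= 0) then evol n m (P tri1 m x)
  else if n < m <= 0 then - evol n m (x - P tri1 m x)
  else if 0 < m <= n then evol n m (x - P tri2 m x)
  else - evol n m (P tri2 m x).

(* [summability.sum] is the unordered sum: the limit of the finite partial
   sums along the finite subsets of int. *)
Definition green_op (y : int -> X) : int -> X :=
  fun n => summability.sum (fun m : int => green n (m + 1) (y (m + 1))).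

End Trichotomy.

Section Shadowing.
Variables (R : realType) (B : normedSeqSpace R) (X : completeNormedModType R).
Variable F : int -> X -> X.

Definition pseudotrajectory (d : R) (y : int -> X) : Prop :=
  XB B (fun n => y (n + 1) - F n (y n)) /\
  XBnorm B (fun n => y (n + 1) - F n (y n)) <= d.

Definition shadowed (e : R) (y : int -> X) : Prop :=
  exists x : int -> X, [/\ forall n, x (n + 1) = F n (x n),
    XB B (fun n => x n - y n) & XBnorm B (fun n => x n - y n) <= e].

Definition lipschitz_shadowing : Prop :=
  exists2 L : R, 0 < L & forall e : R, 0 < e ->
    forall y, pseudotrajectory (L * e) y -> shadowed e y.

End Shadowing.

(* Main.v *)
Require Import Defs.
From HB Require Import structures.
From mathcomp Require Import all_boot all_order all_algebra.
From mathcomp Require Import all_classical all_reals all_analysis.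
From mathcomp Require Import finmap zify ring lra.

Set Implicit Arguments.
Unset Strict Implicit.
Unset Printing Implicit Defensive.
Import Order.TTheory GRing.Theory Num.Theory.
Import numFieldNormedType.Exports.
Local Open Scope classical_set_scope.
Local Open Scope ring_scope.

(** The system is the perturbation x_{n+1} = A_n x_n + f_n(x_n) of a linear
    one whose inhomogeneous equation is solved by the operator G.  Let y be a
    pseudotrajectory with defect d_n = y_{n+1} - A_n y_n - f_n(y_n).  A sequence
    y + z is an exact trajectory iff
      z_{n+1} - A_n z_n = f_n(y_n + z_n) - f_n(y_n) - d_n,
    and this holds as soon as z = G (w z), where (w z)_{n+1} is the right-hand
    side.  The norm of B is shift invariant and each f_n is c-Lipschitz, so w is
    c-Lipschitz for the norm of X_B and G o w is (c ||G||)-Lipschitz: it is a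
    contraction.  Its fixed point z satisfies
      ||z|| <= ||G (w 0)|| / (1 - c ||G||) <= ||G|| ||d|| / (1 - c ||G||),
    a Lipschitz bound in ||d||, which is what shadowing asks for.

    Three facts carry the argument.

    - G maps X_B to itself (green_op_sum), so that its operator norm can be
      used.  The trichotomy gives |G(n,m) x| <= D q^|n-m| |x| with q < 1
      (green_bound), so the series for (G y)_n is dominated by the sum over k of
      D q^k (|y_{n+k}| + |y_{n-k}|), a series of shifts of an element of B which
      converges geometrically in B (geometric_majorant).

    - G solves the inhomogeneous equation (green_op_solves), because its kernel
      satisfies G(n+1,m) = A_n G(n,m) except for a unit jump at m = n+1
      (green_step).  The jump is P x + (x - P x) = x, where P is P^1 if m <= 0
      and Id - P^2 if m > 0: the kernel propagates forward one part of x and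
      backward, where A is invertible, the complementary part.

    - Contractions of X_B have fixed points (XB_lipschitz_fixpoint).  The
      completeness of X_B is again an application of geometric_majorant, to the
      norms of the successive differences of Picard iterates; the limit itself
      is taken coordinatewise in X. *)

(** * Unordered sums *)

#[local] Existing Instance summability.totally_filter.

Section UnorderedSums.
Variables (R : realType) (I : choiceType) (V : completeNormedModType R).
Implicit Types x y : I -> V.

Definition has_sum x (l : V) :=
  summability.partial_sum x @ summability.totally --> l.

Lemma has_sum_sum x l : has_sum x l -> summability.sum x = l.
Proof. by move=> h; apply: cvg_lim h => //; exact: norm_hausdorff. Qed.

Lemma partial_sumE x (J : {fset I}) :
  summability.partial_sum x J = \sum_(i <- J) x i.
Proof. by rewrite /summability.partial_sum (big_seq_fsetE _ _ predT). Qed.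

Lemma has_sum_lin a x y l l' : has_sum x l -> has_sum y l' ->
  has_sum (fun i => a *: x i + y i) (a *: l + l').
Proof.
move=> hx hy; rewrite /has_sum.
have -> : summability.partial_sum (fun i => a *: x i + y i) =
    (fun J => a *: summability.partial_sum x J + summability.partial_sum y J).
  by apply/funext => J; rewrite /summability.partial_sum big_split scaler_sumr.
by apply: cvgD => //; apply: cvgZr.
Qed.

Lemma has_sum_comp (T : {linear V -> V}) x l : continuous T ->
  has_sum x l -> has_sum (T \o x) (T l).
Proof.
move=> cT hx; rewrite /has_sum.
have -> : summability.partial_sum (T \o x) = T \o summability.partial_sum x.
  by apply/funext => J; rewrite /= /summability.partial_sum linear_sum.
by apply: cvg_comp; [exact: hx | exact: cT].
Qed.

Lemma has_sum_delta j (v : V) : has_sum (fun i => if i == j then v else 0) v.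
Proof.
apply: cvg_near_cst; exists [fset j]%fset => // J /= jJ.
rewrite partial_sumE (bigD1_seq j) /= ?fset_uniq //; last first.
  by apply: (fsubsetP jJ); rewrite inE.
by rewrite eqxx big1 ?addr0 // => i /negPf ->.
Qed.

(** An absolutely bounded family is Cauchy along the finite subsets: once a
    finite set nearly realises the supremum of the sums of norms, whatever is
    added to it contributes little. *)
Lemma bounded_has_sum x (b : R) :
  (forall J : {fset I}, \sum_(i <- J) `|x i| <= b) ->
  has_sum x (summability.sum x) /\ `|summability.sum x| <= b.
Proof.
move=> hb; pose S := [set \sum_(i <- J) `|x i| | J in [set: {fset I}]].
have hS : has_sup S.
  split; first by exists (\sum_(i <- fset0) `|x i|), fset0.
  by exists b => _ [J _ <-]; exact: hb.
have cx : has_sum x (summability.sum x).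
  apply/cauchy_cvgP/cauchy_exP => e e0.
  have [_ [J0 _ <-] hJ0] := sup_adherent e0 hS.
  exists (summability.partial_sum x J0); exists J0 => // J /= J0J.
  have J0E : [fset i | i in J & i \in J0]%fset = J0.
    apply/fsetP => i; rewrite !inE andbC.
    by case: (boolP (i \in J0)) => //= /(fsubsetP J0J) ->.
  rewrite !partial_sumE -ball_normE /= (big_fsetID _ (mem J0) J) /= J0E.
  rewrite opprD addNKr normrN; apply: le_lt_trans (ler_norm_sum _ _ _) _.
  have : \sum_(i <- J) `|x i| <= sup S.
    by apply: sup_upper_bound => //; exists J.
  rewrite (big_fsetID _ (mem J0) J) /= J0E.
  by move: hJ0; lra.
split => //.
have : `|summability.partial_sum x J| @[J --> summability.totally] -->
    `|summability.sum x|.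
  exact: cvg_norm.
apply: (closed_cvg (fun r => r <= b) (@closed_le _ b) _ _).
by apply: nearW => J /=; rewrite partial_sumE (le_trans (ler_norm_sum _ _ _)).
Qed.

End UnorderedSums.

Lemma ler_sum_incl (R : realType) (I : eqType) (F : I -> R) (s t : seq I) :
  (forall i, 0 <= F i) -> uniq s -> {subset s <= t} ->
  \sum_(i <- s) F i <= \sum_(i <- t) F i.
Proof.
move=> F0; elim: s t => [|i s IH] t /=.
  by move=> _ _; rewrite big_nil sumr_ge0.
move=> /andP[iNs us] st.
have it : i \in t by apply: st; rewrite inE eqxx.
rewrite big_cons (big_rem i it) /= lerD2l; apply: IH => // j js.
have jt : j \in t by apply: st; rewrite inE js orbT.
move: jt; rewrite (perm_mem (perm_to_rem it)) inE => /orP[/eqP ji|//].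
by move: iNs; rewrite -ji js.
Qed.

(** * Geometric series in the sequence space *)

Section SequenceSpace.
Variables (R : realType) (B : normedSeqSpace R).
Hypothesis hB : admissible B.
Hypothesis hB1 : seqnorm B \1_[set 0] = 1.
Local Notation N := (seqnorm B).

(** Solidity compares s n times the indicator of 0 with a shift of s; shifts
    preserve the norm, and the indicator has norm 1. *)
Lemma ler_seqnorm_coord s n : seqs B s -> `|s n| <= N s.
Proof.
move=> Bs; have [Bs' Ns'] := adm_shift hB n Bs.
have [B1 _] := adm_indic hB 0.
rewrite -Ns' -[leLHS]mulr1 -hB1 -[leLHS]seqnormZ //.
apply: ler_seqnorm => // j; rewrite indicE; have [->|/eqP j0] := eqVneq j 0.
  by rewrite mem_set // mulr1 add0r.
by rewrite memNset // mulr0 normr0.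
Qed.

Lemma geometric_vanish (q M : R) : 0 <= q -> q < 1 ->
  forall e, 0 < e -> exists K, forall k, (K <= k)%N -> M * q ^+ k < e.
Proof.
move=> q0 q1 e e0.
have : M * q ^+ k @[k --> \oo] --> M * 0.
  by apply: cvgMr; apply: cvg_expr; rewrite ger0_norm.
rewrite mulr0 => /cvgrPdist_lt /(_ _ e0)[K _ hK]; exists K => k Kk.
by have := hK _ Kk; rewrite /= sub0r normrN; apply: le_lt_trans; rewrite ler_norm.
Qed.

Lemma seqsB s t : seqs B s -> seqs B t -> seqs B (fun n => s n - t n).
Proof.
move=> Bs Bt; have := seqsD Bs (seqsZ (-1) Bt).
by congr seqs; apply/funext => n; rewrite mulN1r.
Qed.

(** A series of nonnegative terms whose norms decay geometrically has Cauchy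
    partial sums, hence a limit in B.  Norm convergence implies coordinatewise
    convergence and the partial sums increase, so the limit dominates all of
    them.  Only the majorant and its norm matter below: solidity turns a
    pointwise bound by the majorant into membership in X_B with a norm bound. *)
Lemma geometric_majorant (v : nat -> int -> R) (M q : R) :
  0 <= q -> q < 1 -> (forall k n, 0 <= v k n) ->
  (forall k, seqs B (v k)) -> (forall k, N (v k) <= M * q ^+ k) ->
  exists s, [/\ seqs B s, N s <= M / (1 - q) &
    forall K n, \sum_(k < K) v k n <= s n].
Proof.
move=> q0 q1 v0 Bv Nv.
have q1' : 0 < 1 - q by lra.
have M0 : 0 <= M.
  by have := Nv 0; rewrite expr0 mulr1; apply: le_trans; exact: seqnorm_ge0.
pose u K n := \sum_(k < K) v k n.
have uS K : u K.+1 = (fun n => u K n + v K n).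
  by apply/funext => n; rewrite /u big_ord_recr.
have Bu K : seqs B (u K).
  elim: K => [|K IH]; last by rewrite uS; exact: seqsD.
  have -> : u 0 = (fun=> 0) by apply/funext => n; rewrite /u big_ord0.
  exact: seqs0.
have N0 : N (fun=> 0) = 0.
  have /= := seqnormZ 0 (seqs0 B); rewrite normr0 [RHS]mul0r => {2}<-.
  by congr N; apply/funext => n; rewrite mul0r.
have Ntail L j : N (fun n => u (L + j)%N n - u L n) <=
    M * (q ^+ L - q ^+ (L + j)) / (1 - q).
  elim: j => [|j IH].
    rewrite addn0 subrr mulr0 mul0r.
    rewrite (_ : (fun n => _) = (fun=> 0)) ?N0 //.
    by apply/funext => n; rewrite subrr.
  rewrite addnS uS.
  have -> : (fun n => u (L + j)%N n + v (L + j)%N n - u L n) =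
            (fun n => (u (L + j)%N n - u L n) + v (L + j)%N n).
    by apply/funext => n; rewrite addrAC.
  apply: le_trans (ler_seqnormD _ (Bv _)) _; first exact: seqsB.
  apply: le_trans (lerD IH (Nv _)) _.
  rewrite le_eqVlt; apply/orP; left; apply/eqP.
  by rewrite exprS; field; lra.
have Ntail' L k : (L <= k)%N ->
    N (fun n => u k n - u L n) <= M / (1 - q) * q ^+ L.
  move=> Lk; rewrite -(subnKC Lk); apply: le_trans (Ntail _ _) _.
  rewrite [leRHS]mulrAC ler_wpM2r ?invr_ge0 ?(ltW q1') // ler_wpM2l //.
  by rewrite gerBl exprn_ge0.
have Nsym s t : seqs B s -> seqs B t ->
    N (fun n => s n - t n) <= N (fun n => t n - s n).
  move=> Bs Bt; apply: ler_seqnorm; first exact: seqsB.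
  by move=> n; rewrite distrC.
have [e e0|s Bs us] := adm_banach hB Bu.
  have [K hK] := geometric_vanish (M / (1 - q)) q0 q1 e0; exists K => k l Kk Kl.
  case: (leqP l k) => lk.
    by apply: le_lt_trans (Ntail' _ _ lk) _; exact: hK.
  apply: le_lt_trans (Nsym _ _ (Bu _) (Bu _)) _.
  by apply: le_lt_trans (Ntail' _ _ (ltnW lk)) _; exact: hK.
have us' e : 0 < e ->
    exists K, forall k, (K <= k)%N -> N (fun n => u k n - s n) < e.
  move=> e0; have /cvgrPdist_lt /(_ _ e0)[K _ hK] := us; exists K => k Kk.
  have := hK _ Kk; rewrite /= sub0r normrN ger0_norm //.
  by apply: seqnorm_ge0; exact: seqsB.
exists s; split => //.
- apply/ler_addgt0Pr => e e0; have [K hK] := us' _ e0.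
  have -> : s = (fun n => u K n + (s n - u K n)).
    by apply/funext => n; rewrite addrC subrK.
  apply: le_trans (ler_seqnormD (Bu _) (seqsB Bs (Bu _))) _; apply: lerD.
    have := Ntail' 0%N K (leq0n K); rewrite expr0 mulr1; apply: le_trans.
    apply: ler_seqnorm; first exact: seqsB.
    by move=> n; rewrite /u big_ord0 subr0.
  apply: le_trans (Nsym _ _ Bs (Bu _)) _; apply: ltW; exact: hK.
- move=> K n; apply/ler_addgt0Pr => e e0; have [L hL] := us' _ e0.
  pose k := maxn K L.
  have h1 : u K n <= u k n.
    rewrite /k -(subnKC (leq_maxl K L)); elim: (_ - _)%N => [|j IH].
      by rewrite addn0.
    by rewrite addnS uS (le_trans IH) // lerDl.
  have h2 := ler_seqnorm_coord n (seqsB (Bu k) Bs).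
  have h3 := hL k (leq_maxr K L).
  have := ler_norm (u k n - s n); rewrite -/(u K n); lra.
Qed.

End SequenceSpace.

(** * The space X_B and its contractions *)

Section VectorValued.
Variables (R : realType) (B : normedSeqSpace R).
Hypothesis hB : admissible B.
Hypothesis hB1 : seqnorm B \1_[set 0] = 1.
Variable X : completeNormedModType R.
Implicit Types x y : int -> X.
Local Notation XBs := (XB B (X := X)).
Local Notation NX := (XBnorm B (X := X)).

Lemma XB_dominated x s : seqs B s -> (forall n, `|x n| <= s n) ->
  XBs x /\ NX x <= seqnorm B s.
Proof.
move=> Bs xs; have h n : `| `|x n| | <= `|s n|.
  by rewrite normr_id (le_trans (xs n)) ?ler_norm.
by split; [exact: (seqs_solid Bs h) | exact: (ler_seqnorm Bs h)].
Qed.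

Lemma XB_normD x y : XBs x -> XBs y -> XBs (x + y) /\ NX (x + y) <= NX x + NX y.
Proof.
move=> Bx By.
have [h1 h2] : XBs (x + y) /\ NX (x + y) <= seqnorm B (fun n => `|x n| + `|y n|).
  by apply: XB_dominated; [exact: seqsD | move=> n; exact: ler_normD].
by split => //; apply: le_trans h2 (ler_seqnormD Bx By).
Qed.

Lemma XBZ a x : XBs x -> XBs (a *: x).
Proof.
move=> /(seqsZ `|a|); congr seqs; apply/funext => n.
by rewrite /= normrZ.
Qed.

Lemma XBnormZ a x : XBs x -> NX (a *: x) = `|a| * NX x.
Proof.
move=> /(seqnormZ `|a|); rewrite normr_id => <-; congr (seqnorm B _).
by apply/funext => n; rewrite normrZ.
Qed.

Lemma XB0 : XBs 0 /\ NX 0 = 0.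
Proof.
have B0 : XBs 0.
  have := seqs0 B; congr seqs; apply/funext => n; by rewrite /= normr0.
split=> //; have := XBnormZ 0 B0; by rewrite scale0r normr0 mul0r.
Qed.

Lemma XB_normB x y : XBs x -> XBs y -> XBs (x - y) /\ NX (x - y) <= NX x + NX y.
Proof.
move=> Bx By; have := XB_normD Bx (XBZ (-1) By).
by rewrite XBnormZ // normrN normr1 mul1r scaleN1r.
Qed.

Lemma XBnorm_ge0 x : XBs x -> 0 <= NX x.
Proof. exact: seqnorm_ge0. Qed.

Lemma ler_XBnorm_coord x n : XBs x -> `|x n| <= NX x.
Proof.
by move=> Bx; have := ler_seqnorm_coord hB hB1 n Bx; rewrite normr_id.
Qed.

Lemma XB_shift x (m : int) : XBs x ->
  XBs (fun n => x (n + m)) /\ NX (fun n => x (n + m)) = NX x.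
Proof. exact: (adm_shift hB m). Qed.

(** The contraction principle for X_B, in which completeness enters through
    geometric_majorant: applied to the tails of the series of successive
    differences of the Picard iterates z_K, it bounds every z_{K+j} - z_K by one
    element of B of norm O(q^K).  The coordinatewise limit inherits this bound,
    so the iterates converge to it in norm. *)
Lemma XB_lipschitz_fixpoint (T : (int -> X) -> (int -> X)) (q : R) :
  0 <= q -> q < 1 -> (forall x, XBs x -> XBs (T x)) ->
  (forall x y, XBs x -> XBs y -> NX (T x - T y) <= q * NX (x - y)) ->
  exists z, [/\ XBs z, T z = z & NX z <= NX (T 0) / (1 - q)].
Proof.
move=> q0 q1 BT lipT; pose z k := iter k T 0; pose M := NX (T 0).
have q1' : 0 < 1 - q by lra.
have Bz k : XBs (z k) by elim: k => [|k IH]; [exact: XB0.1 | exact: BT].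
have Nv k : NX (z k.+1 - z k) <= M * q ^+ k.
  elim: k => [|k IH]; first by rewrite /z /= subr0 expr0 mulr1.
  apply: (le_trans (lipT (z k.+1) (z k) (Bz _) (Bz _))).
  by rewrite exprS mulrCA ler_wpM2l.
have maj K : exists s, [/\ seqs B s, seqnorm B s <= M / (1 - q) * q ^+ K &
    forall j n, `|z (K + j)%N n - z K n| <= s n].
  have [k n|k|k|s [Bs Ns hs]] := @geometric_majorant _ _ hB hB1
    (fun k n => `|(z (K + k).+1 - z (K + k)%N) n|) (M * q ^+ K) q q0 q1.
  - by [].
  - exact: (XB_normB (Bz _) (Bz _)).1.
  - by apply: le_trans (Nv _) _; rewrite exprD mulrA.
  exists s; split => //; first by rewrite mulrAC.
  move=> j n; apply: le_trans (hs j n); elim: j => [|j IH].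
    by rewrite addn0 subrr normr0 big_ord0.
  rewrite big_ord_recr /= addnS -(subrKA (z (K + j)%N n)) addrC.
  apply: le_trans (ler_normD _ _) _; exact: lerD.
have zcvg n : cvg (z k n @[k --> \oo]).
  apply/cauchy_cvgP/cauchy_exP => e e0.
  have [K hK] := geometric_vanish (M / (1 - q)) q0 q1 e0.
  exists (z K n), K => // k /= Kk; rewrite -ball_normE /= distrC.
  have [s [Bs Ns hs]] := maj K.
  rewrite -(subnKC Kk); apply: le_lt_trans (hs _ _) _.
  apply: le_lt_trans (ler_norm _) _.
  apply: le_lt_trans (ler_seqnorm_coord hB hB1 n Bs) _.
  by apply: le_lt_trans Ns _; exact: hK.
pose l n := lim (z k n @[k --> \oo]).
have dist K : XBs (l - z K) /\ NX (l - z K) <= M / (1 - q) * q ^+ K.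
  have [s [Bs Ns hs]] := maj K.
  have [|h1 h2] := @XB_dominated (l - z K) s Bs; last first.
    by split => //; apply: le_trans Ns.
  move=> n /=; have : `|z k n - z K n| @[k --> \oo] --> `|l n - z K n|.
    by apply: cvg_norm; apply: cvgB; [exact: zcvg | exact: cvg_cst].
  apply: (closed_cvg (fun r => r <= s n) (@closed_le _ _) _ _).
  by exists K => // k /= Kk; rewrite -(subnKC Kk).
have [Bl Nl] := dist 0%N; rewrite /z /= subr0 in Bl.
exists l; split => //; last by move: Nl; rewrite /z /= subr0 expr0 mulr1.
apply/funext => n; apply/eqP; rewrite -subr_eq0 -normr_le0.
apply/ler_addgt0Pr => e e0; rewrite add0r.
(* T l n - l n splits into a difference of values of T and the error of the next
   iterate; each of the two is at most M / (1 - q) * q ^+ K. *)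
have [K hK] := geometric_vanish (M / (1 - q) * 2) q0 q1 e0.
have [Bd0 Nd0] := dist K; have [Bd1 Nd1] := dist K.+1.
have C0 : 0 <= M / (1 - q).
  by rewrite divr_ge0 ?(ltW q1') //; apply: XBnorm_ge0; exact: (BT _ XB0.1).
have h1 := lipT _ _ Bl (Bz K).
have h2 := ler_XBnorm_coord n (XB_normB (BT _ Bl) (BT _ (Bz K))).1.
have h3 := ler_XBnorm_coord n Bd1.
have h4 : `|T l n - l n| <= `|(T l - T (z K)) n| + `|(l - z K.+1) n|.
  have -> : T l n - l n = (T l - T (z K)) n - (l - z K.+1) n.
    by rewrite /z /= -/(z K) !fctE opprB addrA subrK.
  exact: ler_normB.
have h5 : q * NX (l - z K) <= M / (1 - q) * q ^+ K.
  apply: le_trans Nd0; rewrite ler_piMl ?XBnorm_ge0 //; exact: ltW.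
have h6 : M / (1 - q) * q ^+ K.+1 <= M / (1 - q) * q ^+ K.
  by rewrite ler_wpM2l // exprS ler_piMl ?exprn_ge0 // ltW.
by have := hK K (leqnn _); rewrite mulrAC; lra.
Qed.

End VectorValued.

(** * Operator norms *)

Section OperatorNorm.
Variables (R : realType) (V : lmodType R) (D : set V) (N : V -> R).
Hypothesis DZ : forall a x, D x -> D (a *: x).
Hypothesis NZ : forall a x, D x -> N (a *: x) = `|a| * N x.
Hypothesis N0 : forall x, D x -> 0 <= N x.

(** The supremum over the unit ball bounds N (T x) by scaling.  When N x = 0 every
    multiple of x lies in the unit ball, and the images of these multiples are
    bounded only if N (T x) = 0. *)
Lemma opnorm_bound (T : V -> V) (g : R) :
  (forall x, D x -> D (T x)) -> (forall a x, D x -> T (a *: x) = a *: T x) ->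
  (opnorm D N T <= g%:E)%E -> forall x, D x -> N (T x) <= g * N x.
Proof.
move=> DT TZ hg x Dx.
have h t : 0 <= t -> t * N x <= 1 -> t * N (T x) <= g.
  move=> t0 tx; rewrite -lee_fin; apply: le_trans hg; apply: ereal_sup_ubound.
  exists (t *: x); last by rewrite TZ // NZ ?ger0_norm //; exact: DT.
  by split; [exact: DZ | rewrite NZ ?ger0_norm].
have [Nx|Nx] := eqVneq (N x) 0.
  rewrite Nx mulr0; have Tx := N0 (DT _ Dx); rewrite leNgt; apply/negP => p.
  have g0 : 0 <= g by have := h 0; rewrite !mul0r; apply.
  have := h ((g + 1) / N (T x)); rewrite Nx mulr0 divfK ?gt_eqF // => /(_ _ ler01).
  by rewrite divr_ge0 ?addr_ge0 //; lra.
have Nx' : 0 < N x by rewrite lt_neqAle eq_sym Nx N0.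
have := h (N x)^-1; rewrite mulVf // invr_ge0 ltW // => /(_ isT (lexx _)).
by rewrite mulrC ler_pdivrMr.
Qed.

End OperatorNorm.

(** * Evolution along the trichotomy and the Green kernel *)

Section Evolution.
Variables (R : realType) (X : completeNormedModType R).
Variables (A : int -> {linear X -> X}) (P : tri -> int -> {linear X -> X}).
Hypothesis hP : exp_trichotomy A P.
Local Notation ker1 m := (opker (P tri1 m)).
Local Notation U := (evol A P).
Local Notation Gr := (green A P).

Lemma forward_lin n k a x y :
  forward A n k (a *: x + y) = a *: forward A n k x + forward A n k y.
Proof. by elim: k => //= k ->; rewrite linearP. Qed.

Lemma forwardSl n k x : forward A n k.+1 x = forward A (n + 1) k (A n x).
Proof.
elim: k => [|k IH]; first by rewrite /= addr0.
rewrite [LHS]/= -/(forward A n k.+1 x) IH /=.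
by have -> : n + k.+1%:Z = n + 1 + k%:Z by lia.
Qed.

Lemma forward_bij n k : set_bij (ker1 n) (ker1 (n + k%:Z)) (forward A n k).
Proof.
elim: k => [|k IH]; first by rewrite addr0; split => // x Kx; exists x.
have := set_bij_comp IH (tri_inv hP (n + k%:Z)).
by have -> : n + k%:Z + 1 = n + k.+1%:Z by lia.
Qed.

Lemma ker1_lin m a x y : ker1 m x -> ker1 m y -> ker1 m (a *: x + y).
Proof. by rewrite /opker /= => x0 y0; rewrite linearP x0 y0 scaler0 addr0. Qed.

Lemma ker1P2 m x : ker1 m (P tri2 m x).
Proof. exact: (tri_orth hP). Qed.

Lemma ker1P3 m x : ker1 m (P tri3 m x).
Proof. exact: (tri_orth hP). Qed.

Lemma ker1_compl m x : x - P tri1 m x = P tri2 m x + P tri3 m x.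
Proof. by apply/eqP; rewrite subr_eq addrC addrA (tri_sum hP). Qed.

Lemma ker1B m x : ker1 m (x - P tri1 m x).
Proof. by rewrite /opker /= linearB /= (tri_idem hP) subrr. Qed.

Lemma evol_forward n k : U (n + k%:Z) n = forward A n k.
Proof. by rewrite /evol lerDl /= addrC addKr. Qed.

Lemma evol_id n : U n n = id.
Proof. by rewrite -{1}[n]addr0 (evol_forward n 0). Qed.

(** Together with the injectivity of the forward maps on the kernels of P^1, this
    characterises the backward evolution; its cocycle property and its linearity
    follow by comparing forward images. *)
Lemma evol_back n k x : ker1 (n + k%:Z) x ->
  ker1 n (U n (n + k%:Z) x) /\ forward A n k (U n (n + k%:Z) x) = x.
Proof.
case: k => [|k] Kx; first by rewrite addr0 evol_id; rewrite addr0 in Kx.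
have [_ _ sj] := forward_bij n k.+1.
have -> : U n (n + k.+1%:Z) =
    'pinv_(fun=> 0) (ker1 n) (forward A n k.+1).
  rewrite /evol ifF; last by apply/negP; lia.
  by congr ('pinv_ _ _ (forward _ _ _)); lia.
split; last by apply: (surjpK _ sj); exact: mem_set.
by apply: (surjpinv_image_sub sj); exists x.
Qed.

Lemma evol_succ_ge n m x : m <= n -> U (n + 1) m x = A n (U n m x).
Proof.
move=> mn; have -> : n = m + `|n - m|%N%:Z by lia.
set k := `|_|%N; have -> : m + k%:Z + 1 = m + k.+1%:Z by lia.
by rewrite !evol_forward.
Qed.

Lemma evol_succ_lt n m x : n < m -> ker1 m x -> U (n + 1) m x = A n (U n m x).
Proof.
move=> nm; have [k ->] : exists k, m = n + k.+1%:Z.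
  by exists (`|m - n|%N.-1); lia.
move=> Kx; have [K1 e1] := evol_back Kx.
have e : n + k.+1%:Z = n + 1 + k%:Z by lia.
rewrite e in Kx K1 e1 *; have [K2 e2] := evol_back Kx.
have [_ inj _] := forward_bij (n + 1) k.
have [f _ _] := tri_inv hP n.
apply: inj; [exact: mem_set | by apply: mem_set; exact: f |].
by rewrite e2 -forwardSl.
Qed.

Lemma evol_lin n m a x y : ker1 m x -> ker1 m y ->
  U n m (a *: x + y) = a *: U n m x + U n m y.
Proof.
case: (leP m n) => mn.
  have -> : n = m + `|n - m|%N%:Z by lia.
  by rewrite evol_forward forward_lin.
have -> : m = n + `|m - n|%N%:Z by lia.
set k := `|_|%N => Kx Ky.
have [K1 e1] := evol_back Kx; have [K2 e2] := evol_back Ky.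
have [K3 e3] := evol_back (ker1_lin a Kx Ky).
have [_ inj _] := forward_bij n k.
apply: inj; [exact: mem_set | by apply: mem_set; exact: ker1_lin |].
by rewrite e3 forward_lin e1 e2.
Qed.

Lemma evol_lin_ge n m a x y : m <= n ->
  U n m (a *: x + y) = a *: U n m x + U n m y.
Proof.
move=> mn; have -> : n = m + `|n - m|%N%:Z by lia.
by rewrite evol_forward forward_lin.
Qed.

(** The case distinction that defines the kernel depends only on the sign of m
    and on whether n is before m. *)
Lemma green_cases n m x :
  [\/ [/\ m <= 0, m <= n & Gr n m x = U n m (P tri1 m x)],
      [/\ m <= 0, n < m & Gr n m x = - U n m (x - P tri1 m x)],
      [/\ 0 < m, m <= n & Gr n m x = U n m (x - P tri2 m x)] |
      [/\ 0 < m, n < m & Gr n m x = - U n m (P tri2 m x)]].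
Proof.
have [m0|m0] : m <= 0 \/ 0 < m by lia.
  have [mn|mn] : m <= n \/ n < m by lia.
    by constructor 1; split => //; rewrite /green ifT //; lia.
  by constructor 2; split => //; rewrite /green ifF ?ifT //; lia.
have [mn|mn] : m <= n \/ n < m by lia.
  constructor 3; split => //; rewrite /green.
  by do 2 (rewrite ifF; last by lia); rewrite ifT //; lia.
by constructor 4; split => //; rewrite /green; do 3 (rewrite ifF; last by lia).
Qed.

Lemma green_lin n m a x y : Gr n m (a *: x + y) = a *: Gr n m x + Gr n m y.
Proof.
have oppL (V : lmodType R) (u v : V) : - (a *: u + v) = a *: - u + - v.
  by rewrite opprD scalerN.
have subL (T : {linear X -> X}) :
    a *: x + y - T (a *: x + y) = a *: (x - T x) + (y - T y).
  by rewrite linearP scalerBr opprD addrACA.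
case: (green_cases n m x) => -[m0 mn ->];
  case: (green_cases n m y) => -[m0' mn' ->];
  case: (green_cases n m (a *: x + y)) => -[m0'' mn'' ->];
  try (exfalso; lia); rewrite ?subL ?oppL.
- by rewrite linearP evol_lin_ge.
- by rewrite evol_lin ?oppL //; exact: ker1B.
- by rewrite evol_lin_ge.
- by rewrite linearP evol_lin ?oppL //; exact: ker1P2.
Qed.

(** In each of the four regions the kernel follows the cocycle, so the only jump
    is at m = n + 1, where the forward and backward parts recombine into x. *)
Lemma green_step n m x :
  Gr (n + 1) m x = A n (Gr n m x) + (if n + 1 == m then x else 0).
Proof.
have AN u : A n (- u) = - A n u by exact: linearN.
case: eqVneq => [<-{m}|nm].
  case: (green_cases (n + 1) (n + 1) x) => -[m0 mn ->]; [|lia| |lia];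
  case: (green_cases n (n + 1) x) => -[m0' mn' ->]; try (exfalso; lia).
    rewrite AN -evol_succ_lt ?evol_id; [|lia|exact: ker1B].
    by rewrite opprB subrK.
  rewrite AN -evol_succ_lt ?evol_id; [|lia|exact: ker1P2].
  by rewrite addrC.
rewrite addr0.
case: (green_cases (n + 1) m x) => -[m0 mn ->];
  case: (green_cases n m x) => -[m0' mn' ->];
  try (exfalso; lia).
- by rewrite evol_succ_ge.
- by rewrite AN evol_succ_lt //; exact: ker1B.
- by rewrite evol_succ_ge.
- by rewrite AN evol_succ_lt //; exact: ker1P2.
Qed.

(** Backward evolution is linear on the kernel of P^1, which contains the ranges
    of P^2 and P^3 but not that of P^1; hence the restriction on i if n < m. *)
Lemma evol_proj_bound i n m (g : R) : (n < m -> i <> tri1) ->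
  (normX (U n m \o P i m) <= g%:E)%E -> forall x, `|U n m (P i m x)| <= g * `|x|.
Proof.
move=> hi hg x.
apply: (@opnorm_bound R X [set: X] Num.norm _ _ _ (U n m \o P i m)) => //=.
- by move=> a {}x _; rewrite normrZ.
- move=> a {}x _; rewrite -[a *: x]addr0 linearP linear0.
  have U0 : U n m 0 = 0.
    have K0 : ker1 m 0 by exact: linear0.
    have := evol_lin n (-1) K0 K0.
    by rewrite scaler0 addr0 scaleN1r addNr.
  case: (leP m n) => [mn|/hi iN1]; first by rewrite evol_lin_ge // U0 addr0.
  rewrite evol_lin ?U0 ?addr0 //; last exact: linear0.
  by apply: (tri_orth hP) => i1; exact: iN1.
Qed.

(** The complementary projections are P^2 + P^3 on the half-line m <= 0 and
    P^1 + P^3 on m > 0.  P^3 decays backward on the first and forward on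
    the second, like its companion, so each case of the kernel is a sum of at
    most two exponentially small terms; hence the constant 2 C. *)
Lemma green_bound : exists D q : R, [/\ 0 <= D, 0 <= q, q < 1 &
  forall n m x, `|Gr n m x| <= D * q ^+ `|n - m|%N * `|x|].
Proof.
have [C [l [C0 l0 [h1 h2 h3 h4]]]] := tri_exp hP.
exists (2 * C), (expR (- l)); split.
- by rewrite mulr_ge0 // ltW.
- exact: expR_ge0.
- by rewrite expR_lt1; lra.
move=> n m x; rewrite -expRM_natl.
set E := expR _; have E0 : 0 <= E by exact: expR_ge0.
have Cx : 0 <= C * E * `|x| by rewrite !mulr_ge0 // ltW.
have Ege : m <= n -> expR (- l * (n - m)%:~R) = E.
  move=> mn; rewrite /E mulrC; congr (expR (_ * _)).
  by rewrite natr_absz; congr (_ %:~R); lia.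
have Ele : n <= m -> expR (- l * (m - n)%:~R) = E.
  move=> mn; rewrite /E mulrC; congr (expR (_ * _)).
  by rewrite natr_absz; congr (_ %:~R); lia.
have two u v : `|u| <= C * E * `|x| -> `|v| <= C * E * `|x| ->
    `|u + v| <= 2 * C * E * `|x|.
  by move=> hu hv; apply: le_trans (ler_normD _ _) _; lra.
have one (u : X) : `|u| <= C * E * `|x| -> `|u| <= 2 * C * E * `|x| by lra.
case: (green_cases n m x) => -[m0 mn ->].
- apply: one; apply: evol_proj_bound; first by lia.
  by rewrite -Ege //; exact: h1.
- rewrite normrN ker1_compl -[P tri2 m x]scale1r evol_lin;
    [|exact: ker1P2|exact: ker1P3].
  rewrite scale1r; apply: two; apply: evol_proj_bound => //.
    by rewrite -Ele ?(ltW mn) //; apply: h2; exact: ltW.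
  by rewrite -Ele ?(ltW mn) //; apply: h4 => //; exact: ltW.
- have -> : x - P tri2 m x = 1 *: P tri1 m x + P tri3 m x.
    apply/eqP; rewrite scale1r subr_eq -addrA [P tri3 m x + _]addrC addrA.
    by rewrite (tri_sum hP).
  rewrite evol_lin_ge // scale1r; apply: two; apply: evol_proj_bound => //;
    rewrite -?Ege //.
  + by lia.
  + exact: h1.
  + by apply: h3 => //; exact: ltW.
- rewrite normrN; apply: one; apply: evol_proj_bound => //.
  by rewrite -Ele ?(ltW mn) //; apply: h2; exact: ltW.
Qed.

End Evolution.

(** * The Green operator on X_B *)

Section GreenOperator.
Variables (R : realType) (B : normedSeqSpace R).
Hypothesis hB : admissible B.
Hypothesis hB1 : seqnorm B \1_[set 0] = 1.
Variable X : completeNormedModType R.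
Variables (A : int -> {linear X -> X}) (P : tri -> int -> {linear X -> X}).
Hypothesis hA : forall m, bounded_near (A m) (nbhs (0 : X)).
Hypothesis hP : exp_trichotomy A P.
Local Notation XBs := (XB B (X := X)).
Local Notation NX := (XBnorm B (X := X)).
Local Notation G := (green_op A P).

(** The geometric decay of the kernel dominates every finite partial sum of the
    series for (G y)_n by the partial sums of a geometric series of symmetrised
    shifts of y; their majorant in B gives at once the summability at each n and
    the membership of G y in X_B. *)
Lemma green_op_sum y : XBs y -> XBs (G y) /\
  forall n, has_sum (fun m => green A P n (m + 1) (y (m + 1))) (G y n).
Proof.
move=> By; have [D [q [D0 q0 q1 hD]]] := green_bound hP.
pose v (k : nat) (n : int) := D * q ^+ k * (`|y (n + k%:Z)| + `|y (n - k%:Z)|).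
have vk k : seqs B (v k) /\ seqnorm B (v k) <= (2 * D * NX y) * q ^+ k.
  have [Bp Np] := XB_shift hB k%:Z By; have [Bm Nm] := XB_shift hB (- k%:Z) By.
  have Bs : seqs B (fun n => `|y (n + k%:Z)| + `|y (n - k%:Z)|) by exact: seqsD.
  split; first exact: seqsZ.
  rewrite seqnormZ // ger0_norm ?mulr_ge0 ?exprn_ge0 //.
  have := ler_seqnormD Bp Bm; rewrite -/(NX _) Np -/(NX _) Nm => h.
  have Dq : 0 <= D * q ^+ k by rewrite mulr_ge0 ?exprn_ge0.
  apply: le_trans (ler_wpM2l Dq h) _.
  by rewrite le_eqVlt; apply/orP; left; apply/eqP; ring.
have v0 k n : 0 <= v k n by rewrite !mulr_ge0 ?exprn_ge0 ?addr_ge0.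
have [s [Bs _ hs]] := geometric_majorant hB hB1 q0 q1 v0
  (fun k => (vk k).1) (fun k => (vk k).2).
have hsum n (J : {fset int}) :
    \sum_(m <- J) `|green A P n (m + 1) (y (m + 1))| <= s n.
  pose K := (\max_(m <- J) `|(m - (n - 1))%R|%N).+1.
  apply: le_trans (hs K n).
  (* The finite index set J lies in a window centred at n - 1, the index where
     the kernel G(n, m + 1) is on its diagonal; the window is listed by the
     distance k to its centre. *)
  pose right := [seq n - 1 + k%:Z | k <- iota 0 K].
  pose left := [seq n - 1 - k%:Z | k <- iota 0 K].
  pose F m := `|green A P n (m + 1) (y (m + 1))|.
  have sub : {subset (J : seq int) <= right ++ left}.
    move=> m mJ; have mK : (`|(m - (n - 1))%R| < K)%N.
      by rewrite ltnS (big_rem m mJ) leq_maxl.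
    rewrite mem_cat; apply/orP; case: (leP (n - 1) m) => mn; [left | right];
      apply/mapP; exists `|(m - (n - 1))%R|%N; rewrite ?mem_iota //; lia.
  have F0 m : 0 <= F m by exact: normr_ge0.
  apply: le_trans (ler_sum_incl F0 (fset_uniq J) sub) _.
  rewrite big_cat /= !big_map -big_split /= -(big_mkord predT (fun k => v k n)).
  rewrite /index_iota subn0; apply: ler_sum => k _.
  rewrite /F /v mulrDr; apply: lerD; apply: le_trans (hD _ _ _) _.
    have -> : n - 1 + k%:Z + 1 = n + k%:Z by lia.
    by have -> : `|(n - (n + k%:Z))%R|%N = k by lia.
  have -> : n - 1 - k%:Z + 1 = n - k%:Z by lia.
  by have -> : `|(n - (n - k%:Z))%R|%N = k by lia.
split; last by move=> n; apply: (bounded_has_sum (hsum n)).1.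
by apply: (XB_dominated Bs _).1 => n; apply: (bounded_has_sum (hsum n)).2.
Qed.

Lemma green_op_lin a x y : XBs x -> XBs y -> G (a *: x + y) = a *: G x + G y.
Proof.
move=> Bx By; apply/funext => n; apply: has_sum_sum.
have := has_sum_lin (a := a) ((green_op_sum Bx).2 n) ((green_op_sum By).2 n).
by congr has_sum; apply/funext => m; rewrite -green_lin.
Qed.

(** Summing green_step over m: A_n commutes with the sum by continuity and the
    jump contributes the single term at m = n. *)
Lemma green_op_solves y n : XBs y -> G y (n + 1) = A n (G y n) + y (n + 1).
Proof.
move=> By; apply: has_sum_sum.
have cA : continuous (A n) by apply/linear_bounded_continuous.
have h1 := has_sum_comp cA ((green_op_sum By).2 n).
have := has_sum_lin (a := 1) h1 (@has_sum_delta _ _ _ n (y (n + 1))).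
rewrite scale1r; congr has_sum; apply/funext => m.
rewrite scale1r /= (green_step hP); congr (_ + _).
by rewrite (inj_eq (addIr 1)) eq_sym; case: eqVneq => // ->.
Qed.

End GreenOperator.

(** * Lipschitz shadowing *)

Theorem theorem3 (R : realType) (B : normedSeqSpace R) (hB : admissible B)
    (hB1 : seqnorm B \1_[set 0] = 1) (X : completeNormedModType R)
    (A : int -> {linear X -> X})
    (hA : forall m, bounded_near (A m) (nbhs (0 : X)))
    (P : tri -> int -> {linear X -> X}) (hP : exp_trichotomy A P)
    (c : R) (hc : 0 < c) (f : int -> X -> X)
    (hf : forall n x y, `|f n x - f n y| <= c * `|x - y|)
    (hG : (c%:E * opnorm (XB B (X := X)) (XBnorm B (X := X)) (green_op A P) < 1)%E) :
  lipschitz_shadowing B (fun n x => A n x + f n x).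
Proof.
set G := green_op A P in hG *; pose XBs := XB B (X := X); pose NX := XBnorm B (X := X).
have BG x : XBs x -> XBs (G x) by move=> /(green_op_sum hB hB1 hP)[].
have GZ a x : XBs x -> G (a *: x) = a *: G x.
  have G0 : G 0 = 0.
    have := green_op_lin hB hB1 hP (-1) (XB0 B X).1 (XB0 B X).1.
    by rewrite scaler0 addr0 scaleN1r addNr.
  move=> Bx; have := green_op_lin hB hB1 hP a Bx (XB0 B X).1.
  by rewrite -/G G0 !addr0.
(* Since c > 0, the hypothesis on c times the operator norm makes the norm
   finite. *)
have [g [g0 hg cg]] : exists g : R, [/\ 0 <= g,
    forall x, XBs x -> NX (G x) <= g * NX x & c * g < 1].
  have op0 : (0 <= opnorm XBs NX G)%E.
    have [B0 N0] := XB0 B X.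
    apply: (@le_trans _ _ (NX (G 0))%:E).
      by rewrite lee_fin; apply: XBnorm_ge0; exact: BG.
    by apply: ereal_sup_ubound; exists 0 => //; split => //; rewrite /NX N0.
  move: hG op0; rewrite -/XBs -/NX; case E : (opnorm XBs NX G) => [g||] //.
    rewrite -EFinM lte_fin lee_fin => cg g0; exists g; split => //.
    apply: (@opnorm_bound R (int -> X) XBs NX) => //.
    - by move=> a x; exact: XBZ.
    - by move=> a x; exact: XBnormZ.
    - by move=> x; exact: XBnorm_ge0.
    - by rewrite E.
  by rewrite gt0_muley // lte_fin.
have q1 : 0 < 1 - c * g by lra.
(* The fixed point has norm at most g * L * e / (1 - c * g).  The ideal choice
   L = (1 - c * g) / g is undefined for g = 0, hence g + 1 in its place. *)
exists ((1 - c * g) / (g + 1)); first by rewrite divr_gt0 //; lra.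
move=> e e0 y []; set d : int -> X := (fun n => y (n + 1) - _) => Bd Nd.
(* The forcing that acts between n and n + 1 enters green_op_solves with the
   index n + 1, whereas f and the defect carry the index n. *)
pose w (z : int -> X) : int -> X :=
  fun n => f (n - 1) (y (n - 1) + z (n - 1)) - f (n - 1) (y (n - 1)) - d (n - 1).
have shift z : XBs z -> XBs (fun n => z (n - 1)) /\ NX (fun n => z (n - 1)) = NX z.
  by move=> Bz; exact: (XB_shift hB (-1) Bz).
have lipw z z' : XBs z -> XBs z' ->
    XBs (w z - w z') /\ NX (w z - w z') <= c * NX (z - z').
  move=> Bz Bz'; have [Bs Ns] := shift _ (XB_normB Bz Bz').1.
  rewrite -Ns; have -> : c * NX (fun n => (z - z') (n - 1)) =
      NX (c *: (fun n => (z - z') (n - 1))).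
    by rewrite /NX XBnormZ // ger0_norm // ltW.
  apply: XB_dominated; first exact: (XBZ c Bs).
  move=> n; rewrite fctE /= normrZ ger0_norm ?(ltW hc) //.
  have dropC (a b u : X) : a + u - (b + u) = a - b.
    by rewrite opprD addrACA subrr addr0.
  rewrite /w !dropC; apply: le_trans (hf _ _ _) _.
  by rewrite ![y _ + _]addrC dropC.
have [Bw0 Nw0] : XBs (w 0) /\ NX (w 0) = NX d.
  have [Bs Ns] := shift _ Bd.
  have -> : w 0 = -1 *: (fun n => d (n - 1)).
    by apply/funext => n; rewrite /w /= addr0 subrr sub0r scaleN1r.
  by split; [exact: XBZ | rewrite /NX XBnormZ // normrN normr1 mul1r].
have Bw z : XBs z -> XBs (w z).
  move=> Bz; rewrite -(subrK (w 0) (w z)).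
  exact: (XB_normD (lipw _ _ Bz (XB0 B X).1).1 Bw0).1.
have GB x x' : XBs x -> XBs x' -> G (x - x') = G x - G x'.
  move=> Bx Bx'; have := green_op_lin hB hB1 hP (-1) Bx' Bx.
  by rewrite !scaleN1r addrC [RHS]addrC.
have cg0 : 0 <= c * g by rewrite mulr_ge0 // ltW.
have [||z [Bz Tz Nz]] := @XB_lipschitz_fixpoint _ _ hB hB1 X
  (G \o w) (c * g) cg0 cg.
- by move=> x Bx; apply: BG; exact: Bw.
- move=> x x' Bx Bx' /=; rewrite -GB; [|exact: Bw|exact: Bw].
  have [Bww Nww] := lipw _ _ Bx Bx'.
  apply: le_trans (hg _ Bww) _; rewrite mulrC [c * g]mulrC -mulrA.
  by rewrite mulrC ler_wpM2l.
have zy : (fun n => y n + z n - y n) = z.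
  by apply/funext => n; rewrite addrAC subrr add0r.
exists (fun n => y n + z n); split.
- move=> n; have := green_op_solves hB hB1 hA hP n (Bw _ Bz).
  rewrite -/G -[G (w z)]/((G \o w) z) Tz => ->.
  have regroup (u v p a b : X) : u + (p + (a - b - (u - (v + b)))) = v + p + a.
    rewrite opprB [v + b]addrC [a - b + _]addrA [a - b + _]addrA subrK.
    by rewrite addrCA [u + _]addrC subrK addrC -addrA addrC.
  by rewrite /w addrK /d regroup linearD.
- by rewrite zy.
- rewrite zy; apply: le_trans Nz _.
  rewrite ler_pdivrMr //; apply: le_trans (hg _ Bw0) _; rewrite Nw0.
  apply: (@le_trans _ _ (g * ((1 - c * g) / (g + 1) * e))); first exact: ler_wpM2l.
  rewrite -[leRHS](_ : (1 - c * g) * e * 1 = _); last by ring.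
  have -> : g * ((1 - c * g) / (g + 1) * e) = (1 - c * g) * e * (g / (g + 1)).
    by field; lra.
  rewrite ler_wpM2l ?mulr_ge0 ?(ltW q1) ?(ltW e0) // ler_pdivrMr; lra.
Qed.
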